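(* Let $S$ be a commutative semigroup with finitely many archimedean components. Then $S$ is weakly noetherian if and only if the quotient semigroup $S/\mathcal{H}$ is finitely generated (as a semigroup).
   Context: An ideal of a commutative semigroup $S$ is a subset $I\subseteq S$ with $IS\subseteq I$; it is finitely generated if $I=X\cup XS$ for some finite $X\subseteq I$. A commutative semigroup is weakly noetherian if every ideal of it is finitely generated. An archimedean semigroup is a commutative semigroup $A$ such that for all $a,b\in A$ there exist $n\in\mathbb{N}$ (with $n\geq 1$) and $s\in A$ with $a^n=bs$. Every commutative semigroup $S$ is a semilattice of archimedean semigroups: it is a disjoint union of archimedean subsemigroups $S_\alpha$ indexed by a semilattice $Y$ with $S_\alpha S_\beta\subseteq S_{\alpha\beta}$; the $S_\alpha$ are the archimedean components of $S$. They are the classes of the equivalence relation: $a\sim b$ iff there exist $m,n\geq1$ and $s,t\in S$ with $a^n=bs$ and $b^m=at$. Green's relation $\mathcal{H}$ is the intersection of $\mathcal{L}$ and $\mathcal{R}$ (generating the same principal left, respectively right, ideal); on a commutative semigroup it is the congruence given by $a\,\mathcal{H}\,b\iff \{a\}\cup aS=\{b\}\cup bS$. *)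

(* Defs.v *)
From HB Require Import structures.
From mathcomp Require Import all_boot.
From mathcomp Require Import boolp classical_sets functions cardinality.

Set Implicit Arguments.
Unset Strict Implicit.
Unset Printing Implicit Defensive.

Local Open Scope classical_set_scope.
Local Open Scope group_scope.
Local Open Scope quotient_scope.

HB.mixin Record Semigroup_isCommutative G of Semigroup G := {
  mulgC : commutative (@mul G)
}.

#[short(type="comSemigroupType")]
HB.structure Definition ComSemigroup :=
  {G of Semigroup_isCommutative G & Semigroup G}.

Section Semigroups.
Variable S : semigroupType.
Implicit Types (a b : S) (A X : set S).

(* A semigroup has no unit, so this is a^n for n > 0 only; the value at n = 0
   is the junk value a. *)
Definition sexp a n := iterop n *%g a a.

Definition mul_set A X : set S := [set a * x | a in A & x in X].

Definition subsemigroup A := mul_set A A `<=` A.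

Definition finitely_generated :=
  exists X, finite_set X /\ smallest subsemigroup X = [set: S].

Definition principal_lideal a : set S := [set a] `|` mul_set [set: S] [set a].
Definition principal_rideal a : set S := [set a] `|` mul_set [set a] [set: S].

Definition greenL a b := principal_lideal a = principal_lideal b.
Definition greenR a b := principal_rideal a = principal_rideal b.

Definition greenH : rel S := fun a b => `[< greenL a b /\ greenR a b >].

Fact greenH_refl : reflexive greenH.
Proof. by move=> a; apply/asboolP. Qed.

Fact greenH_sym : symmetric greenH.
Proof.
by move=> a b; apply/asboolP/asboolP => -[? ?]; split; apply: esym.
Qed.

Fact greenH_trans : transitive greenH.
Proof.
move=> b a c /asboolP[lab rab] /asboolP[lbc rbc]; apply/asboolP.
by split; [apply: etrans lbc | apply: etrans rbc].
Qed.

Canonical greenH_equiv := EquivRel greenH greenH_refl greenH_sym greenH_trans.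

Definition greenH_quot := {eq_quot greenH}.

HB.instance Definition _ := Choice.on greenH_quot.
HB.instance Definition _ := EqQuotient.on greenH_quot.

End Semigroups.

Section CommutativeSemigroups.
Variable S : comSemigroupType.
Implicit Types (a b c : S) (I A X : set S).

Definition ideal I := mul_set I [set: S] `<=` I.

Definition ideal_finitely_generated I :=
  exists X, [/\ finite_set X, X `<=` I & I = X `|` mul_set X [set: S]].

Definition weakly_noetherian :=
  forall I, ideal I -> ideal_finitely_generated I.

Definition archimedean A :=
  forall a b, A a -> A b ->
    exists n s, [/\ (0 < n)%N, A s & sexp a n = b * s].

Definition archimedean_equiv a b :=
  (exists n s, (0 < n)%N /\ sexp a n = b * s) /\
  (exists m t, (0 < m)%N /\ sexp b m = a * t).

Definition archimedean_component a : set S := [set b | archimedean_equiv a b].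

Definition archimedean_components : set (set S) := range archimedean_component.

Lemma principal_lidealE a : principal_lideal a = principal_rideal a.
Proof.
congr (_ `|` _); apply/seteqP; split=> x /=.
  by move=> [s _ [_ -> <-]]; exists a => //; exists s => //; apply: mulgC.
by move=> [_ -> [s _ <-]]; exists s => //; exists a => //; apply: mulgC.
Qed.

Lemma greenHP a b : reflect (principal_rideal a = principal_rideal b)
  (greenH a b).
Proof.
apply: (iffP (asboolP _)) => [[]//|ab].
by split=> //; rewrite /greenL !principal_lidealE.
Qed.

Lemma principal_ridealP a b :
  principal_rideal a `<=` principal_rideal b <-> principal_rideal b a.
Proof.
split=> [ab|]; first by apply: ab; left.
move=> [->//|[_ -> [s _ <-]]] x [->|[_ -> [t _ <-]]].
  by right; exists b => //; exists s.
by right; exists b => //; exists (s * t) => //; apply: mulgA.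
Qed.

Lemma greenH_mulr c a b : greenH a b -> greenH (a * c) (b * c).
Proof.
have h (x y : S) : principal_rideal y x -> principal_rideal (y * c) (x * c).
  move=> [->|[_ -> [s _ <-]]]; first by left.
  by right; exists (y * c) => //; exists s => //; rewrite -!mulgA (mulgC c).
move=> /greenHP ab; apply/greenHP/seteqP; split; apply/principal_ridealP.
  by apply: h; rewrite -ab; left.
by apply: h; rewrite ab; left.
Qed.

Definition greenH_mul : greenH_quot S -> greenH_quot S -> greenH_quot S :=
  lift_op2 (greenH_quot S) (@mul S).

Lemma pi_greenH_mul : {morph \pi_(greenH_quot S) : a b / a * b >-> greenH_mul a b}.
Proof.
move=> a b; unlock greenH_mul; apply/eqmodP => /=.
set a' := repr _; set b' := repr _.
have Ha : greenH a a' by apply/eqmodP; rewrite reprK.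
have Hb : greenH b b' by apply/eqmodP; rewrite reprK.
apply: (greenH_trans (greenH_mulr b Ha)).
by rewrite ![a' * _]mulgC; apply: greenH_mulr.
Qed.

Fact greenH_mulA : associative greenH_mul.
Proof.
by elim/quotW=> a; elim/quotW=> b; elim/quotW=> c; rewrite -!pi_greenH_mul mulgA.
Qed.

Fact greenH_mulC : commutative greenH_mul.
Proof. by elim/quotW=> a; elim/quotW=> b; rewrite -!pi_greenH_mul mulgC. Qed.

HB.instance Definition _ := isSemigroup.Build (greenH_quot S) greenH_mulA.
HB.instance Definition _ :=
  Semigroup_isCommutative.Build (greenH_quot S) greenH_mulC.

Lemma mulgCA a b c : a * (b * c) = b * (a * c).
Proof. by rewrite !mulgA (mulgC a). Qed.

Lemma sexpS a n : (0 < n)%N -> sexp a n.+1 = a * sexp a n.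
Proof. by case: n. Qed.

Lemma sexpD a m n : (0 < m)%N -> (0 < n)%N ->
  sexp a (m + n) = sexp a m * sexp a n.
Proof.
case: m => // m _ n0; elim: m => [|m IHm]; first by rewrite add1n sexpS.
by rewrite addSn sexpS // IHm (@sexpS a m.+1) // mulgA.
Qed.

Lemma sexpM a m n : (0 < m)%N -> (0 < n)%N ->
  sexp a (m * n) = sexp (sexp a m) n.
Proof.
move=> m0; case: n => // n _; elim: n => [|n IHn]; first by rewrite muln1.
by rewrite mulnS sexpD ?muln_gt0 ?m0 // IHn (@sexpS _ n.+1).
Qed.

Lemma sexpMl a b n : (0 < n)%N -> sexp (a * b) n = sexp a n * sexp b n.
Proof.
case: n => // n _; elim: n => // n IHn.
by rewrite !(@sexpS _ n.+1) // IHn -!mulgA (mulgCA b).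
Qed.

(* The classes of archimedean_equiv are archimedean subsemigroups, and S is a
   semilattice of them. *)

Lemma archimedean_equiv_refl a : archimedean_equiv a a.
Proof. by split; exists 2, a. Qed.

Lemma archimedean_equiv_sym a b : archimedean_equiv a b -> archimedean_equiv b a.
Proof. by case. Qed.

Lemma archimedean_equiv_trans b a c :
  archimedean_equiv a b -> archimedean_equiv b c -> archimedean_equiv a c.
Proof.
have h (x y z : S) : (exists n s, (0 < n)%N /\ sexp x n = y * s) ->
    (exists m t, (0 < m)%N /\ sexp y m = z * t) ->
    exists n s, (0 < n)%N /\ sexp x n = z * s.
  move=> [n [s [n0 xn]]] [m [t [m0 ym]]]; exists (n * m)%N, (t * sexp s m).
  by rewrite muln_gt0 n0 m0 sexpM // xn sexpMl // ym mulgA.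
by move=> [ab ba] [bc cb]; split; [apply: h bc | apply: h ba].
Qed.

Lemma archimedean_equiv_mulr c a b :
  archimedean_equiv a b -> archimedean_equiv (a * c) (b * c).
Proof.
have h (x y : S) : (exists n s, (0 < n)%N /\ sexp x n = y * s) ->
    exists n s, (0 < n)%N /\ sexp (x * c) n = (y * c) * s.
  move=> [n [s [n0 xn]]]; exists n.+1, (x * (s * sexp c n)); split=> //.
  rewrite sexpMl // !(@sexpS _ n) // xn -!mulgA.
  by rewrite (mulgCA x y) (mulgCA s c) (mulgCA x c).
by move=> [ab ba]; split; apply: h.
Qed.

Lemma archimedean_equiv_idem a : archimedean_equiv (a * a) a.
Proof.
split; first by exists 1%N, a.
by exists 3, a; split=> //; rewrite /sexp /= mulgA.
Qed.

Lemma archimedean_component_mul a b :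
  mul_set (archimedean_component a) (archimedean_component b) `<=`
  archimedean_component (a * b).
Proof.
move=> _ [x ax [y bY <-]]; apply: (@archimedean_equiv_trans (x * b)).
  exact: archimedean_equiv_mulr.
by rewrite ![x * _]mulgC; apply: archimedean_equiv_mulr.
Qed.

Lemma archimedean_component_subsemigroup a :
  subsemigroup (archimedean_component a).
Proof.
move=> x /archimedean_component_mul; apply: archimedean_equiv_trans.
exact/archimedean_equiv_sym/archimedean_equiv_idem.
Qed.

Lemma archimedean_component_archimedean a :
  archimedean (archimedean_component a).
Proof.
move=> x y ax ay; have [[n [s [n0 xn]]] [m [t [m0 ym]]]] :=
  archimedean_equiv_trans (archimedean_equiv_sym ax) ay.
exists n.+1, (s * x); split=> //; last by rewrite sexpS // xn mulgC -mulgA.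
apply: archimedean_equiv_trans ax _; split.
  by exists n.+1, y; split=> //; rewrite sexpS // xn mulgA mulgC mulgA.
by exists 1%N, s; split=> //; apply: mulgC.
Qed.

End CommutativeSemigroups.

Arguments weakly_noetherian : clear implicits.
Arguments archimedean_components : clear implicits.

(* Main.v *)
(** Weak noetherianity says that every subset P of S has a finite subset F such
    that each element of P is divisible by an element of F.  This property
    passes between S and S/H, and S/H is partially ordered by divisibility.

    If S/H is finitely generated, it has the property by Dickson's argument.

    Conversely, in a commutative semigroup partially ordered by divisibility and
    with this property, the elements a such that a = b c only if a = b or a = c
    form a generating set, by noetherian induction.  An archimedean component
    contains no three of them with a | b | c properly: irreducibility forces
    b = a b, and hence b = a^n b for all n > 0; as c divides some a^n, it
    divides b.  Each component thus contains finitely many of them. *)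
Require Import Defs.
From mathcomp Require Import all_boot.
From mathcomp Require Import boolp classical_sets functions cardinality.

Set Implicit Arguments.
Unset Strict Implicit.
Unset Printing Implicit Defensive.

Local Open Scope classical_set_scope.
Local Open Scope group_scope.
Local Open Scope quotient_scope.

(** * Divisibility and finite bases *)

Section Divisibility.
Variable S : comSemigroupType.
Implicit Types (a b c : S) (D F P : set S).

Definition divides a b := principal_rideal a b.

Lemma dividesP a b : divides a b <-> b = a \/ exists s, b = a * s.
Proof.
split=> [[->|[_ -> [s _ <-]]]|[->|[s ->]]]; [by left|by right; exists s|by left|].
by right; exists a => //; exists s.
Qed.

Lemma divides_refl a : divides a a.
Proof. by left. Qed.

Lemma divides_mulr a b : divides a (a * b).
Proof. by apply/dividesP; right; exists b. Qed.

Lemma divides_mull a b : divides b (a * b).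
Proof. by rewrite mulgC; apply: divides_mulr. Qed.

Lemma divides_trans b a c : divides a b -> divides b c -> divides a c.
Proof. by move=> /principal_ridealP ab /principal_ridealP bc; apply/ab/bc; left. Qed.

Lemma divides_mul2l c a b : divides a b -> divides (c * a) (c * b).
Proof.
move=> /dividesP[->|[s ->]]; first exact: divides_refl.
by rewrite mulgA; apply: divides_mulr.
Qed.

Lemma greenH_divides a b : divides a b -> divides b a -> greenH a b.
Proof. by move=> ab ba; apply/greenHP/seteqP; split; apply/principal_ridealP. Qed.

(** In order-theoretic terms, divisibility is a well-quasi-order on [D]. The parameter [D] lets
    Dickson's argument enlarge the set one generator at a time. *)
Definition finitely_based D := forall P, P `<=` D ->
  exists F, [/\ finite_set F, F `<=` P &
    forall p, P p -> exists2 f, F f & divides f p].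

(** Given [P], each of the finitely many generators of the ideal of multiples of [P] has a divisor
    in [P], and these divisors form the basis. Conversely, a finite basis of an ideal generates
    it. *)
Lemma weakly_noetherianP : weakly_noetherian S <-> finitely_based [set: S].
Proof.
split=> [wnS P _|fbS I idI].
- pose I := [set x | exists2 p, P p & divides p x].
  have [|X [finX XI IX]] := wnS I.
    move=> _ [x [p Pp px] [s _ <-]]; exists p => //.
    exact/(divides_trans px)/divides_mulr.
  have /choice[g gP] x : exists p, X x -> P p /\ divides p x.
    case: (pselect (X x)) => [/XI[p Pp px]|nXx]; first by exists p.
    by exists x.
  exists (g @` X); split; first exact: finite_image.
    by move=> _ [x /gP[Pg _] <-].
  move=> p Pp; have: I p by exists p => //; apply: divides_refl.
  rewrite IX => Xp; have [x Xx xp] : exists2 x, X x & divides x p.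
    case: Xp => [Xp|[x Xx [s _ <-]]].
      by exists p => //; apply: divides_refl.
    by exists x => //; apply: divides_mulr.
  by exists (g x); [exists x|have [_ /divides_trans] := gP _ Xx; apply].
- have [F [finF FI Fdiv]] := fbS I (@subsetT _ _); exists F; split=> //.
  apply/seteqP; split=> [x /Fdiv[f Ff /dividesP[->|[s ->]]]|x].
  + by left.
  + by right; exists f => //; exists s.
  + case=> [/FI//|[f Ff [s _ <-]]]; apply: idI.
    by exists f; [exact: FI|exists s].
Qed.

(** * Dickson's argument *)

Definition translates a D : set S :=
  [set iter n (mul a) d | n in [set: nat] & d in D].

Lemma sub_translates a D : D `<=` translates a D.
Proof. by move=> d Dd; exists 0%N => //; exists d. Qed.

Lemma iter_mulCA a b n c : b * iter n (mul a) c = iter n (mul a) (b * c).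
Proof. by elim: n => //= n <-; apply: mulgCA. Qed.

Lemma divides_iter_mul a m n b c :
  (m <= n)%N -> divides b c -> divides (iter m (mul a) b) (iter n (mul a) c).
Proof.
move=> + bc; elim: n => [|n IHn]; first by rewrite leqn0 => /eqP->.
rewrite leq_eqVlt => /predU1P[->|]; last first.
  by rewrite ltnS => /IHn /divides_trans; apply; apply: divides_mull.
elim: n.+1 => //= k; exact: divides_mul2l.
Qed.

(** [slice m] collects the [d] whose translate by the [m]-th power of [a] lies in [P]. A finite
    basis [F] of the union of all slices uses exponents below some [N], so its translates divide
    every element of [P] of exponent at least [N]. The finitely many lower exponents are covered by
    the bases [B m] of their slices. *)
Lemma finitely_based_translates a D :
  finitely_based D -> finitely_based (translates a D).
Proof.
move=> fbD P PaD; pose slice m := [set d | D d /\ P (iter m (mul a) d)].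
have fbslice m : exists F, [/\ finite_set F, F `<=` slice m &
    forall d, slice m d -> exists2 f, F f & divides f d].
  by apply: fbD => d [].
have {fbslice}/choice[B BP] := fbslice.
have [|F [finF FD Fdiv]] := fbD (\bigcup_m slice m).
  by move=> d [m _ []].
have /choice[h hP] d : exists m, F d -> slice m d.
  case: (pselect (F d)) => [/FD[m _ ?]|?]; first by exists m.
  by exists 0%N.
have [N hN] : exists N, forall d, F d -> (h d < N)%N.
  have /finite_seqP[s Fs] := finF; exists (\max_(d <- s) h d).+1 => d.
  by rewrite Fs /= ltnS => ds; exact: leq_bigmax_seq.
exists ((fun d => iter (h d) (mul a) d) @` F `|`
  \bigcup_(m in `I_N) iter m (mul a) @` B m); split.
- rewrite finite_setU; split; first exact: finite_image.
  apply: bigcup_finite => [|m _]; first exact: finite_II.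
  by apply: finite_image; have [] := BP m.
- move=> _ [[d /hP[_ Pd] <-]//|[m _ [d Bd <-]]].
  by have [_ /(_ _ Bd)[]] := BP m.
move=> p Pp; have [n _ [d Dd ndp]] := PaD p Pp; rewrite -ndp in Pp *.
have nd : slice n d by [].
have [nN|Nn] := ltnP n N.
  have [_ _ /(_ _ nd)[f Bf fd]] := BP n.
  exists (iter n (mul a) f); last exact: divides_iter_mul.
  by right; exists n => //; exists f.
have [|f Ff fd] := Fdiv d; first by exists n.
exists (iter (h f) (mul a) f); first by left; exists f.
by apply: divides_iter_mul => //; apply: leq_trans Nn; apply/ltnW/hN.
Qed.

Lemma finitely_generated_based :
  finitely_generated S -> finitely_based [set: S].
Proof.
move=> [X [/finite_seqP[s ->] genX]].
have fbX : finitely_based [set` s].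
  move=> P PX; exists P; split=> //; first exact: sub_finite_set PX (finite_seq s).
  by move=> p Pp; exists p => //; apply: divides_refl.
have [D [fbD sD Dmul]] : exists D, [/\ finitely_based D, [set` s] `<=` D &
    forall a d, a \in s -> D d -> D (a * d)].
  (* Only the list of allowed multipliers grows in the induction; [D] contains all of [s] from the
     start. *)
  elim: {2}s => [|b r [D [fbD sD Dmul]]]; first by exists [set` s]; split=> // a.
  exists (translates b D); split; first exact: finitely_based_translates.
    by move=> a /sD; apply: sub_translates.
  move=> a _ + [n _ [d Dd <-]]; rewrite inE => /predU1P[->|ar].
    by exists n.+1 => //; exists d.
  rewrite iter_mulCA; exists n => //; exists (a * d) => //; exact: Dmul.
suff DT : [set: S] `<=` D by move=> P _; apply: fbD => p _; apply: DT.
rewrite -genX => a genXa; suff [] : D a /\ forall d, D d -> D (a * d) by [].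
(* [D] is only known to be stable under multiplication by generators; the elements of [D] that
   multiply [D] into itself do form a subsemigroup. *)
apply: (genXa [set a | D a /\ forall d, D d -> D (a * d)]); split.
  move=> _ [b [Db bD] [c [Dc cD] <-]]; split=> [|d Dd]; first exact: bD.
  by rewrite -mulgA; apply/bD/cD.
by move=> b sb; split=> [|d]; [exact: sD|exact: Dmul].
Qed.

(** * Irreducible elements when divisibility is antisymmetric *)

Definition irreducible a := forall b c, a = b * c -> b = a \/ c = a.

Hypothesis divides_anti : forall a b, divides a b -> divides b a -> a = b.

Lemma divides_minimal_finite F : finite_set F -> F !=set0 ->
  exists2 m, F m & forall f, F f -> divides f m -> f = m.
Proof.
move=> /finite_seqP[s ->{F}]; elim: s => [|b s IHs]; first by case.
move=> _; case: s IHs => [_|c s].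
  by exists b => [|f] /=; rewrite mem_seq1 // => /eqP.
move: (c :: s) (mem_head c s) => {}s cs [|m ms minm]; first by exists c.
case: (pselect (divides b m)) => [bm|nbm].
  exists b => [|f]; first exact: mem_head.
  rewrite /= inE => /predU1P[->//|fs] fb; apply: divides_anti => //.
  by rewrite (minm f fs (divides_trans fb bm)).
exists m => [|f]; first by rewrite /= inE ms orbT.
by rewrite /= inE => /predU1P[->//|]; apply: minm.
Qed.

(** A minimal element of a finite basis of [P] is minimal in all of [P]. *)
Lemma divides_minimal P : finitely_based [set: S] -> P !=set0 ->
  exists2 m, P m & forall p, P p -> divides p m -> p = m.
Proof.
move=> fbS [p Pp]; have [F [finF FP Fdiv]] := fbS P (@subsetT _ _).
have [|m Fm minm] := divides_minimal_finite finF.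
  by have [f Ff _] := Fdiv p Pp; exists f.
exists m => [|q Pq qm]; first exact: FP.
have [f Ff fq] := Fdiv q Pq; apply: divides_anti => //.
by rewrite -(minm f Ff (divides_trans fq qm)).
Qed.

Lemma smallest_subsemigroup_irreducible : finitely_based [set: S] ->
  smallest (@subsemigroup S) irreducible = [set: S].
Proof.
move=> fbS; apply/seteqP; split=> // a _; apply: contrapT => genNa.
(* Proper divisors of a minimal [m] outside the generated subsemigroup lie inside it, so a
   factorization of [m] into two of them is contradictory. *)
have [|m genNm minm] :=
  @divides_minimal (~` smallest (@subsemigroup S) irreducible) fbS.
  by exists a.
apply: genNm => M [MM irrM].
have [irrm|] := pselect (irreducible m); first exact: irrM.
move=> /existsNP[b /existsNP[c /not_implyP[mbc /not_orP[bm cm]]]].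
have gen x : x <> m -> divides x m -> M x.
  move=> xm xdvdm; have: smallest (@subsemigroup S) irreducible x.
    by apply: contrapT => genNx; apply/xm/minm.
  exact.
apply: MM; rewrite mbc; exists b; last exists c => //.
  by apply: gen => //; rewrite mbc; apply: divides_mulr.
by apply: gen => //; rewrite mbc; apply: divides_mull.
Qed.

(** In [b = a * s] the factor [a] differs from [b], so [s] must be [b]. *)
Lemma irreducible_mul_id a b :
  irreducible b -> divides a b -> a <> b -> a * b = b.
Proof.
move=> irrb /dividesP[->//|[s bas]] ab.
by have [/ab//|sb] := irrb _ _ bas; rewrite -{1}sb.
Qed.

Lemma irreducible_chain a b c : irreducible b -> archimedean_equiv a c ->
  divides a b -> divides b c -> a <> b -> b = c.
Proof.
move=> irrb [[n [s [n0 ancs]]] _] ab bc neab; apply: divides_anti => //.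
have abb := irreducible_mul_id irrb ab neab.
have anbb : sexp a n * b = b.
  case: n n0 {ancs} => // n _; elim: n => // n IHn.
  by rewrite sexpS // -mulgA IHn.
by rewrite -anbb ancs -mulgA; apply: divides_mulr.
Qed.

(** Take a basis [F] of [P], then a basis [G] of the rest. An element [p] outside both tops a chain
    [f], [g], [p] with [f] in [F] and [g] in [G], hence [f] distinct from [g]; then [g = p], which
    is absurd. *)
Lemma finite_irreducible_component a : finitely_based [set: S] ->
  finite_set (irreducible `&` archimedean_component a).
Proof.
move=> fbS; set P := _ `&` _.
have [F [finF FP Fdiv]] := fbS P (@subsetT _ _).
have [G [finG GPF Gdiv]] := fbS (P `\` F) (@subsetT _ _).
have [E|] := pselect (P `<=` F `|` G).
  by apply: (sub_finite_set E); rewrite finite_setU.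
move=> /existsNP[p /not_implyP[Pp /not_orP[nFp nGp]]].
have [g Gg gp] := Gdiv p (conj Pp nFp).
have [Pg nFg] := GPF g Gg; have [f Ff fg] := Fdiv g Pg.
have [[[irrg _] [_ af]] [_ ap]] := (Pg, FP f Ff, Pp).
exfalso; apply: nGp; rewrite -(@irreducible_chain f g p) //.
  exact: archimedean_equiv_trans (archimedean_equiv_sym af) ap.
by move=> fgE; apply: nFg; rewrite -fgE.
Qed.

Lemma finitely_based_generated : finitely_based [set: S] ->
  finite_set (archimedean_components S) -> finitely_generated S.
Proof.
move=> fbS finS; exists irreducible; split; last first.
  exact: smallest_subsemigroup_irreducible.
have -> : irreducible =
    \bigcup_(C in archimedean_components S) (irreducible `&` C).
  rewrite -setI_bigcupr; apply/seteqP; split=> [a irra|a []//].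
  split=> //; exists (archimedean_component a); first by exists a.
  exact: archimedean_equiv_refl.
by apply: bigcup_finite => // _ [a _ <-]; apply: finite_irreducible_component.
Qed.

End Divisibility.

(** * Transfer to the quotient by Green's relation *)

Section GreenQuotient.
Variable S : comSemigroupType.
Local Notation T := (greenH_quot S).
Implicit Types (a b : S) (x y : T).

Lemma pi_greenHM a b : \pi_T (a * b) = \pi_T a * \pi_T b.
Proof. exact: pi_greenH_mul. Qed.

(** Equality of classes is equality of principal ideals, and divisibility depends only on these. *)
Lemma divides_pi a b : divides (\pi_T a) (\pi_T b) <-> divides a b.
Proof.
split=> /dividesP[E|[s E]].
- by move/eqmodP: E => /= /greenHP E; apply/principal_ridealP; rewrite E.
- move: E; rewrite -[s]reprK -pi_greenHM => /eqmodP /= /greenHP E.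
  by apply/principal_ridealP; rewrite E; apply/principal_ridealP/divides_mulr.
- by rewrite E; apply: divides_refl.
- by rewrite E pi_greenHM; apply: divides_mulr.
Qed.

Lemma divides_greenH_anti x y : divides x y -> divides y x -> x = y.
Proof.
elim/quotW: x => a; elim/quotW: y => b /divides_pi ab /divides_pi ba.
by apply/eqmodP; apply: greenH_divides.
Qed.

Lemma finitely_based_greenH :
  finitely_based [set: S] <-> finitely_based [set: T].
Proof.
split=> fb P _.
- have [F [finF FP Fdiv]] := fb (\pi_T @^-1` P) (@subsetT _ _).
  exists (\pi_T @` F); split; first exact: finite_image.
    by move=> _ [a /FP ? <-].
  elim/quotW=> a /Fdiv[f Ff fa].
  by exists (\pi_T f); [exists f|apply/divides_pi].
- have [F [finF FP Fdiv]] := fb (\pi_T @` P) (@subsetT _ _).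
  have /choice[g gP] x : exists a, F x -> P a /\ \pi_T a = x.
    case: (pselect (F x)) => [/FP[a Pa ax]|nFx]; first by exists a.
    by exists (repr x).
  exists (g @` F); split; first exact: finite_image.
    by move=> _ [x /gP[Pg _] <-].
  move=> a Pa; have [|x Fx xa] := Fdiv (\pi_T a); first by exists a.
  exists (g x); first by exists x.
  by have [_ gx] := gP x Fx; apply/divides_pi; rewrite gx.
Qed.

Lemma pi_sexp a n : \pi_T (sexp a n) = sexp (\pi_T a) n.
Proof.
case: n => // n; elim: n => // n IHn.
by rewrite !(@sexpS _ _ n.+1) // pi_greenHM IHn.
Qed.

Lemma archimedean_equiv_pi a b :
  archimedean_equiv a b -> archimedean_equiv (\pi_T a) (\pi_T b).
Proof.
by move=> [[n [s [n0 E]]] [m [t [m0 E']]]]; split;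
  [exists n, (\pi_T s) | exists m, (\pi_T t)];
  rewrite -pi_sexp (E, E') pi_greenHM.
Qed.

Lemma finite_components_greenH : finite_set (archimedean_components S) ->
  finite_set (archimedean_components T).
Proof.
(* Taking a union over [C] avoids choosing a representative; all its members coincide when [C] is a
   component. *)
move=> finS; pose h (C : set S) :=
  \bigcup_(a in C) archimedean_component (\pi_T a).
apply: sub_finite_set (finite_image h finS) => _ [x _ <-].
elim/quotW: x => a; exists (archimedean_component a); first by exists a.
apply/seteqP; split=> [y [b ab by_]|y ay].
  exact: archimedean_equiv_trans (archimedean_equiv_pi ab) by_.
by exists a => //; apply: archimedean_equiv_refl.
Qed.

End GreenQuotient.

Theorem theorem8p5 (S : comSemigroupType)
    (finite_components : finite_set (archimedean_components S)) :
  weakly_noetherian S <-> finitely_generated (greenH_quot S).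
Proof.
rewrite weakly_noetherianP finitely_based_greenH.
split=> [fb|]; last exact: finitely_generated_based.
apply: finitely_based_generated fb (finite_components_greenH finite_components).
exact: divides_greenH_anti.
Qed.
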